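(* Let $(C_n)_{n\ge1}$ be a $\mathrm{Sym}$-invariant chain of cones with limit $C=\bigcup_{n\ge1}C_n\subseteq\mathbb{R}^{(\mathbb{N})}$. The following are equivalent: (i) the chain stabilizes; (ii) there exist $p\in\mathbb{N}$ and a subset $G_p\subseteq\mathbb{R}^p$ such that $C_n=\mathrm{cone}(\mathrm{Sym}(n)(G_p))$ for all $n\ge p$; (iii) there exists $q\in\mathbb{N}$ such that for all $n\ge q$: (a) $C\cap\mathbb{R}^n=C_n$, and (b) for every $(u_1,\dots,u_{n+1})\in C_{n+1}$ there is $\sigma\in\mathrm{Sym}(n+1)$ with $u_{\sigma(n)}u_{\sigma(n+1)}\ge0$ and $(u_{\sigma(1)},\dots,u_{\sigma(n-1)},u_{\sigma(n)}+u_{\sigma(n+1)})\in C_n$; (iv) there exists $q\in\mathbb{N}$ such that for all $n\ge q$: (a) $C\cap\mathbb{R}^n=C_n$, and (b) $C_n$ is generated (as a cone) by elements of support size at most $q$; (v) $C=\mathrm{cone}(\mathrm{Sym}(A))$ for some subset $A\subseteq C_r$ and some $r\in\mathbb{N}$.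
   Context: $\mathbb{R}^{(\mathbb{N})}$ denotes the space of real sequences $(u_i)_{i\in\mathbb{N}}$ with only finitely many nonzero entries; $\mathbb{R}^n$ is identified with the subspace of those with $u_i=0$ for $i>n$. $\mathrm{Sym}$ is the group of permutations of $\mathbb{N}$ fixing all but finitely many elements, acting by $\sigma(u)=\sum_iu_ie_{\sigma(i)}$ (so $\sigma(u)$ has $i$-th entry $u_{\sigma^{-1}(i)}$); $\mathrm{Sym}(n)$ is the subgroup of permutations of $[n]$. $\mathrm{cone}(A)$ is the set of finite nonnegative linear combinations of elements of $A$; $\Gamma(A)=\{\sigma(a)\mid\sigma\in\Gamma,a\in A\}$. A $\mathrm{Sym}$-invariant chain of cones is a sequence $(C_n)_{n\ge1}$ with each $C_n\subseteq\mathbb{R}^n$ a $\mathrm{Sym}(n)$-invariant convex cone and $C_n\subseteq C_{n+1}$; it stabilizes if there is $r$ with $C_n=\mathrm{cone}(\mathrm{Sym}(n)(C_m))$ for all $n\ge m\ge r$. The support size of $u$ is $|\{i\mid u_i\neq0\}|$. *)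

(* Defs.v *)
From mathcomp Require Import all_boot all_order all_algebra.
From mathcomp Require Import finmap.
From mathcomp Require Import all_classical reals.
Set Implicit Arguments.
Unset Strict Implicit.
Unset Printing Implicit Defensive.
Import Order.TTheory GRing.Theory Num.Theory.
Local Open Scope classical_set_scope.
Local Open Scope ring_scope.

(* Real sequences are functions on nat, indexed from 0 (so e_1, e_2, ... are
   the coordinates 0, 1, ...).  R^n is the subspace [Rn R n] below, [n] is
   {0, ..., n-1}, and the space of finitely supported sequences is the union
   of the [Rn R n]. *)

(* [R^o], not [R], so that [rseq R] inherits the pointwise [lmodType R]
   structure. *)
Notation rseq R := (nat -> R^o).

Definition Rn (R : realType) (n : nat) : set (rseq R) :=
  [set u | forall i, (n <= i)%N -> u i = 0].

Arguments Rn R n : clear implicits.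

Definition support_size (R : realType) (u : rseq R) : nat :=
  #|` fset_set [set i | u i != 0] |.

Notation nat_perm := {splitbij [set: nat] >-> [set: nat]}.

Definition Sym : set nat_perm := [set s | finite_set [set i | s i != i]].

(* A permutation of [n] is identified with its extension by the identity. *)
Definition Symn (n : nat) : set nat_perm :=
  [set s | forall i, (n <= i)%N -> s i = i].

Definition act (R : realType) (s : nat_perm) (u : rseq R) : rseq R :=
  u \o s^-1%FUN.

Definition Gamma_orbit (R : realType) (Gamma : set nat_perm) (A : set (rseq R)) :
    set (rseq R) :=
  [set v | exists2 s, Gamma s & exists2 a, A a & v = act s a].

Definition cone (R : realType) (A : set (rseq R)) : set (rseq R) :=
  [set v | exists (k : nat) (c : 'I_k -> R) (a : 'I_k -> rseq R),
     [/\ forall i, 0 <= c i, forall i, A (a i) & v = \sum_i c i *: a i]].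

Definition convex_cone (R : realType) (K : set (rseq R)) : Prop :=
  [/\ K 0, forall u v, K u -> K v -> K (u + v) &
      forall (c : R) u, 0 <= c -> K u -> K (c *: u)].

(* Chains are indexed by n >= 1; the value [C 0] is never used. *)
Definition Sym_invariant_chain (R : realType) (C : nat -> set (rseq R)) : Prop :=
  forall n, (0 < n)%N ->
    [/\ C n `<=` Rn R n, convex_cone (C n),
        forall s u, Symn n s -> C n u -> C n (act s u) & C n `<=` C n.+1].

Definition chain_limit (R : realType) (C : nat -> set (rseq R)) :
    set (rseq R) :=
  \bigcup_(n in [set n | (0 < n)%N]) C n.

Definition stabilizes (R : realType) (C : nat -> set (rseq R)) : Prop :=
  exists2 r, (0 < r)%N &
    forall m n, (r <= m)%N -> (m <= n)%N -> C n = cone (Gamma_orbit (Symn n) (C m)).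

(* The vector (v_1, ..., v_(n-1), v_n + v_(n+1)) of R^n, for n >= 1. *)
Definition merge_last (R : realType) (n : nat) (v : rseq R) : rseq R :=
  fun i => if (i < n.-1)%N then v i
           else if i == n.-1 then v n.-1 + v n
           else 0.

(* Main.v *)
(* (i) => (ii) is clear, and (iii) => (iv) => (v) hold because splitting a merged
   entry proportionally is a nonnegative combination of a vector and a
   transposed copy of it, and because a vector of support size at most q can be
   permuted into R^q.  The remaining steps rest on eliminating a coordinate by
   Fourier-Motzkin: only pairs of generators have to be combined, and for large
   n a pair of them misses some common index, into which the eliminated
   coordinate can be moved.  This gives (a), and (v) => (i).  For (b), a
   Caratheodory representation of u has too few terms of bounded support to
   cover all pairs of indices where u has the same sign; an uncovered pair can
   be merged. *)
From HB Require Import structures.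
Require Import Defs.
From mathcomp Require Import all_boot all_order all_algebra.
From mathcomp Require Import finmap.
From mathcomp Require Import all_classical reals.
From mathcomp Require Import zify ring.
Set Implicit Arguments.
Unset Strict Implicit.
Unset Printing Implicit Defensive.
Import Order.TTheory GRing.Theory Num.Theory.
Local Open Scope classical_set_scope.
Local Open Scope ring_scope.

(** * Convex cones and elimination of a coordinate *)

Section Cones.
Variable R : realType.
Implicit Types (A B K : set (rseq R)) (u v w : rseq R).

Lemma convex_cone_sum K (I : Type) (r : seq I) (F : I -> rseq R) :
  convex_cone K -> (forall i, K (F i)) -> K (\sum_(i <- r) F i).
Proof.
by move=> [K0 KD _] KF; elim/big_ind : _.
Qed.

(** Serves as the induction principle for generated cones: a property passes from generators to
    combinations once it defines a convex cone. *)
Lemma cone_sub A K : convex_cone K -> A `<=` K -> cone A `<=` K.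
Proof.
move=> Kc AK _ [k [c [a [c0 Aa ->]]]]; apply: convex_cone_sum => // i.
by case: Kc => _ _; apply => //; exact: AK.
Qed.

Lemma sub_cone A : A `<=` cone A.
Proof.
move=> u Au; exists 1%N, (fun=> 1), (fun=> u); split=> //.
by rewrite big_ord1 scale1r.
Qed.

Lemma cone_convex A : convex_cone (cone A).
Proof.
split.
- exists 0%N, (fun=> 0), (fun=> 0); split=> //; first by case.
  by rewrite big_ord0.
- move=> _ _ [k [c [a [c0 Aa ->]]]] [l [d [b [d0 Ab ->]]]].
  exists (k + l)%N,
    (fun i : 'I_(k + l) => match fintype.split i with inl j => c j | inr j => d j end),
    (fun i : 'I_(k + l) => match fintype.split i with inl j => a j | inr j => b j end).
  split=> [i|i|]; [by case: fintype.split|by case: fintype.split|].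
  rewrite big_split_ord /=; congr (_ + _); apply: eq_bigr => i _.
    by rewrite (unsplitK (inl i)).
  by rewrite (unsplitK (inr i)).
- move=> t _ t0 [k [c [a [c0 Aa ->]]]].
  exists k, (fun i => t * c i), a; split=> // [i|]; first exact: mulr_ge0.
  by rewrite scaler_sumr; apply: eq_bigr => i _; rewrite scalerA.
Qed.

Lemma cone_mono A B : A `<=` B -> cone A `<=` cone B.
Proof. by move=> AB; apply: cone_sub (cone_convex B) _ => u /AB /sub_cone. Qed.

Lemma rseqDE u v i : (u + v) i = u i + v i. Proof. by []. Qed.

Lemma rseqZE (c : R) u i : (c *: u) i = c * u i. Proof. by []. Qed.

Lemma Rn_mono m n u : (m <= n)%N -> Rn R m u -> Rn R n u.
Proof. by move=> mn um i ni; apply: um; exact: leq_trans ni. Qed.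

Lemma convex_cone_preimage K (f : rseq R -> rseq R) :
  (forall u v, f (u + v) = f u + f v) ->
  (forall (c : R) u, f (c *: u) = c *: f u) ->
  convex_cone K -> convex_cone (f @^-1` K).
Proof.
move=> fD fZ [K0 KD KZ]; split=> /= [|u v Ku Kv|c u c0 Ku].
- by rewrite -(scale0r (0 : rseq R)) fZ scale0r.
- by rewrite fD; exact: KD.
- by rewrite fZ; exact: KZ.
Qed.

(* Fourier-Motzkin elimination of the coordinate [z]: [a] and [b] are combined
   with the weights that cancel their [z]-entries. *)
Lemma cone_elim A K z u : convex_cone K ->
  (forall a, A a -> a z = 0 -> K a) ->
  (forall a b, A a -> A b -> 0 < a z -> b z < 0 ->
     K ((- b z) *: a + a z *: b)) ->
  cone A u -> u z = 0 -> K u.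
Proof.
move=> Kc KA0 KA2 Au uz0; have [K0 KD KZ] := Kc.
pose P := cone (A `&` [set a | 0 < a z]).
pose M := cone (A `&` [set a | a z <= 0]).
(* Generators positive at [z] are grouped into [p], all others, including those vanishing at [z],
   into [m]. *)
have [p [m [Pp Mm upm]]] : exists p m, [/\ P p, M m & u = p + m].
  pose L := [set u | exists p m, [/\ P p, M m & u = p + m]].
  have [P0 PD PZ] := cone_convex (A `&` [set a | 0 < a z]).
  have [M0 MD MZ] := cone_convex (A `&` [set a | a z <= 0]).
  have Lc : convex_cone L.
    split; first by exists 0, 0; split=> //; rewrite addr0.
      move=> _ _ [p [m [Pp Mm ->]]] [p' [m' [Pp' Mm' ->]]].
      by exists (p + p'), (m + m'); split; [exact: PD|exact: MD|rewrite addrACA].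
    move=> c _ c0 [p [m [Pp Mm ->]]].
    by exists (c *: p), (c *: m); split; [exact: PZ|exact: MZ|rewrite scalerDr].
  apply: (cone_sub Lc _ Au) => a Aa.
  have [az|az] := ltP 0 (a z).
    by exists a, 0; split; [exact: sub_cone|exact: M0|rewrite addr0].
  by exists 0, a; split; [exact: P0|exact: sub_cone|rewrite add0r].
(* The combination is linear in [m] and in [p] separately, so it is carried from generators to sums
   one argument at a time. *)
have KM : forall a, A a -> 0 < a z -> K ((- m z) *: a + a z *: m).
  move=> a Aa az.
  suff: [set m : rseq R | K ((- m z) *: a + a z *: m)] m by [].
  apply: (cone_sub _ _ Mm).
    split=> /= [|v w Kv Kw|c v c0 Kv].
    - by rewrite oppr0 scale0r scaler0 addr0.
    - rewrite opprD scalerDl scalerDr addrACA; exact: KD.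
    - rewrite (_ : _ + _ = c *: ((- v z) *: a + a z *: v)); first exact: KZ.
      by rewrite scalerDr !scalerA mulrN (mulrC c (a z)).
  move=> b [Ab /= bz]; have [bz0|bz0] := eqVneq (b z) 0.
    by rewrite bz0 oppr0 scale0r add0r; apply: KZ; [exact: ltW|exact: KA0].
  by apply: KA2 => //; rewrite lt_neqAle bz0.
have KP : K ((- m z) *: p + p z *: m).
  suff: [set p : rseq R | K ((- m z) *: p + p z *: m)] p by [].
  apply: (cone_sub _ _ Pp).
    split=> /= [|v w Kv Kw|c v c0 Kv].
    - by rewrite scale0r scaler0 addr0.
    - rewrite scalerDl scalerDr addrACA; exact: KD.
    - rewrite (_ : _ + _ = c *: ((- m z) *: v + v z *: m)); first exact: KZ.
      by rewrite scalerDr !scalerA (mulrC c (- m z)).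
  by move=> a [Aa az]; exact: KM.
have mpz : - m z = p z.
  by apply/eqP; rewrite eq_sym -subr_eq0 opprK -rseqDE -upm uz0.
have [p0|pz] : [set p : rseq R | p = 0 \/ 0 < p z] p.
  apply: cone_sub Pp => [|a [_ az]]; last by right.
  split=> /= [|v w [->|vz] [->|wz]|c v c0 [->|vz]]; first by left.
  - by left; rewrite addr0.
  - by right; rewrite add0r.
  - by right; rewrite addr0.
  - by right; exact: addr_gt0.
  - by left; rewrite scaler0.
  - move: c0; rewrite le_eqVlt => /predU1P[<-|c0]; first by left; rewrite scale0r.
    by right; exact: mulr_gt0.
(* Here [p = 0], so [m z = 0]; a sum of nonpositive entries vanishes only if each does, and
   generators vanishing at [z] lie in [K]. *)
- have [mz|[_]] : [set m : rseq R | m z < 0 \/ (m z = 0 /\ K m)] m.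
    apply: cone_sub Mm => [|a [Aa /=]]; last first.
      rewrite le_eqVlt => /predU1P[az|az]; last by left.
      by right; split=> //; exact: KA0.
    split=> /= [|v w [vz|[vz Kv]] [wz|[wz Kw]]|c v c0 [vz|[vz Kv]]].
    + by right.
    + by left; exact: ltr_nDl.
    + by left; rewrite rseqDE wz addr0.
    + by left; rewrite rseqDE vz add0r.
    + by right; rewrite rseqDE vz wz addr0; split=> //; exact: KD.
    + move: c0; rewrite le_eqVlt => /predU1P[<-|c0].
        by right; rewrite scale0r; split.
      by left; rewrite rseqZE pmulr_rlt0.
    + by right; rewrite rseqZE vz mulr0; split=> //; exact: KZ.
  + by move: mz; rewrite -oppr_gt0 mpz p0 ltxx.
  + by rewrite upm p0 add0r.
(* Both weights equal [p z], so the combination is a positive multiple of [u]. *)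
- have -> : u = (p z)^-1 *: ((- m z) *: p + p z *: m).
    by rewrite mpz -scalerDr scalerA mulVf ?gt_eqF// scale1r.
  by apply: KZ => //; rewrite invr_ge0 ltW.
Qed.

End Cones.

(** * Finitary permutations of the indices and cones over orbits *)

Section Permutations.
Variable R : realType.
Implicit Types (A G K : set (rseq R)) (u v w : rseq R) (s t : nat_perm).

Lemma permK s : cancel s s^-1%FUN.
Proof. by move=> i; rewrite funK ?inE. Qed.

Lemma permKV s : cancel s^-1%FUN s.
Proof. by move=> i; rewrite invK ?inE. Qed.

Lemma actE s u i : act s u i = u (s^-1%FUN i). Proof. by []. Qed.

Lemma act_perm s u i : act s u (s i) = u i.
Proof. by rewrite actE permK. Qed.

Lemma act_inv s u : act s^-1%FUN u = u \o s.
Proof. by apply/funext => i /=; rewrite -{1}(permK s i) act_perm. Qed.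

Lemma act_compE s t u : act (s \o t) u = act s (act t u).
Proof.
apply/funext => i; rewrite -[i](permKV (s \o t)) act_perm /=.
by rewrite !act_perm.
Qed.

Lemma actK s u : act s^-1%FUN (act s u) = u.
Proof. by rewrite act_inv; apply/funext => i /=; rewrite act_perm. Qed.

Lemma actKV s u : act s (act s^-1%FUN u) = u.
Proof. by rewrite act_inv; apply/funext => i /=; rewrite actE /= permKV. Qed.

Lemma actD s u v : act s (u + v) = act s u + act s v. Proof. by []. Qed.

Lemma actZ s (c : R) u : act s (c *: u) = c *: act s u. Proof. by []. Qed.

Lemma Symn1 n : Symn n (idfun : nat_perm). Proof. by []. Qed.

Lemma SymnV n s : Symn n s -> Symn n (s^-1%FUN : nat_perm).
Proof. by move=> sn i ni; rewrite /= -{1}(sn i ni) permK. Qed.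

Lemma SymnM n s t : Symn n s -> Symn n t -> Symn n (s \o t : nat_perm).
Proof. by move=> sn tn i ni /=; rewrite tn// sn. Qed.

Lemma Symn_mono m n s : (m <= n)%N -> Symn m s -> Symn n s.
Proof. by move=> mn sm i ni; apply: sm; exact: leq_trans ni. Qed.

Lemma Symn_lt n s i : Symn n s -> (s i < n)%N = (i < n)%N.
Proof.
move=> sn; rewrite !ltnNge; congr (~~ _); apply/idP/idP => ni; last by rewrite sn.
by have := SymnV sn ni; rewrite /= permK => ->.
Qed.

Lemma Symn_Sym n s : Symn n s -> Sym s.
Proof.
move=> sn; apply: sub_finite_set (finite_II n) => i /= si.
by rewrite ltnNge; apply: contra si => /sn ->.
Qed.

Lemma Sym_Symn s : Sym s -> exists n, Symn n s.
Proof.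
move=> /finite_fsetP[X sX]; exists (\max_(i <- X) i).+1 => i ni.
apply: contrapT => /eqP si; have iX : i \in X by move/seteqP : sX => [/(_ i si)].
by move: ni; rewrite ltnNge (@leq_bigmax_seq _ (enum_fset X) xpredT id).
Qed.

Lemma Rn_act n s u : Symn n s -> Rn R n u -> Rn R n (act s u).
Proof. by move=> sn un i ni; rewrite actE (SymnV sn)// un. Qed.

Lemma act_convex K s : convex_cone K -> convex_cone (act s @^-1` K).
Proof. exact: convex_cone_preimage (actD s) (actZ s). Qed.

Definition swap (a b i : nat) : nat :=
  if i == a then b else if i == b then a else i.

Lemma swapL a b : swap a b a = b. Proof. by rewrite /swap eqxx. Qed.

Lemma swapR a b : swap a b b = a.
Proof. by rewrite /swap eqxx; case: eqP. Qed.

Lemma swapD a b i : i <> a -> i <> b -> swap a b i = i.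
Proof. by rewrite /swap => /eqP/negPf -> /eqP/negPf ->. Qed.

Lemma swapK a b : involutive (swap a b).
Proof. by move=> i; rewrite /swap; do !case: eqP => //; congruence. Qed.

Lemma swap_bij a b : bijective (swap a b).
Proof. exact: inv_bij (swapK a b). Qed.

HB.instance Definition _ a b := BijTT.Build _ _ (swap a b) (swap_bij a b).

Lemma act_swap a b u i : act (swap a b) u i = u (swap a b i).
Proof. by rewrite -[in LHS](swapK a b i) act_perm. Qed.

Lemma Symn_swap n a b : (a < n)%N -> (b < n)%N -> Symn n (swap a b).
Proof. by move=> an bn i ni; apply: swapD; lia. Qed.

Lemma act_swap_id a b u : u a = u b -> act (swap a b) u = u.
Proof.
by move=> ab; apply/funext => i; rewrite act_swap /swap; do 2?case: eqP => [->|].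
Qed.

(** Pigeonhole; it supplies zero coordinates outside lists that cover the supports. *)
Lemma exists_fresh n (r : seq nat) : (size r < n)%N ->
  exists2 b, (b < n)%N & b \notin r.
Proof.
move=> rn; have [/allP sub|/allPn[b]] := boolP (all (mem r) (iota 0 n)).
  by have := uniq_leq_size (iota_uniq 0 n) sub; rewrite size_iota leqNgt rn.
by rewrite mem_iota => /andP[_ bn] br; exists b.
Qed.

Lemma support_finite n u : Rn R n u -> finite_set [set i | u i != 0].
Proof.
move=> un; apply: sub_finite_set (finite_II n) => i /= ui.
by rewrite ltnNge; apply: contra ui => /un ->.
Qed.

Lemma support_size_Rn n u : Rn R n u -> (support_size u <= n)%N.
Proof.
move=> un; apply: geq_card_fset_set; apply: subset_card_le => i /= ui.
by rewrite ltnNge; apply: contra ui => /un ->.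
Qed.

Lemma support_size_act n s u : Rn R n u -> support_size (act s u) = support_size u.
Proof.
move=> un; have un' := support_finite un; rewrite /support_size.
have -> : [set i | act s u i != 0] = s @` [set i | u i != 0].
  apply/seteqP; split=> [i /= ui|_ /= [i ui <-]]; last by rewrite act_perm.
  by exists (s^-1%FUN i) => //; rewrite permKV.
by rewrite fset_set_image // card_imfset //=; exact: can_inj (permK s).
Qed.

(** A support smaller than the dimension leaves a zero entry, which a transposition moves to the
    last place; iterating removes one dimension at a time. *)
Lemma Rn_compress n m u : (m <= n)%N -> Rn R n u -> (support_size u <= m)%N ->
  exists2 s, Symn n s & Rn R m (act s u).
Proof.
move=> /subnK <-; elim: (n - m)%N u => [|k IH] u; first by exists idfun.
set N := (k + m)%N => un um.
have [b bN ub] : exists2 b, (b < N.+1)%N & u b = 0.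
  have [|b bN] := @exists_fresh N.+1 (fset_set [set i | u i != 0]).
    by apply: leq_ltn_trans um _; rewrite /N; lia.
  rewrite in_fset_set ?notin_setE /=; last exact: support_finite un.
  move=> /negP; rewrite negbK.
  by move/eqP; exists b.
have sN : Symn N.+1 (swap b N) by exact: Symn_swap.
have uN : Rn R N (act (swap b N) u).
  move=> i; rewrite leq_eqVlt => /predU1P[<-|Ni]; first by rewrite act_swap swapR.
  exact: Rn_act sN un _ Ni.
have [|s sk us] := IH (act (swap b N) u) uN.
  by rewrite (support_size_act _ un).
exists (s \o swap b N); last by rewrite act_compE.
by apply: SymnM => //; exact: Symn_mono sk.
Qed.

Lemma orbit_mono m n A : (m <= n)%N ->
  Gamma_orbit (Symn m) A `<=` Gamma_orbit (Symn n) A.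
Proof. by move=> mn _ [s /(Symn_mono mn) ? [a Aa ->]]; exists s => //; exists a. Qed.

Lemma orbit_act n s A u : Symn n s -> Gamma_orbit (Symn n) A u ->
  Gamma_orbit (Symn n) A (act s u).
Proof.
move=> sn [t tn [a Aa ->]]; exists (s \o t); first exact: SymnM.
by exists a => //; rewrite act_compE.
Qed.

Lemma orbit_Rn m n A : A `<=` Rn R m -> (m <= n)%N ->
  Gamma_orbit (Symn n) A `<=` Rn R n.
Proof. by move=> Am mn _ [s sn [a /Am/(Rn_mono mn) an ->]]; exact: Rn_act. Qed.

(** If [t] sends [z] to [n], the hypotheses give [g z = g n = 0]; precomposing [t] with the
    transposition of [z] and [n] then yields the same vector from a permutation fixing [n]. *)
Lemma orbit_shrink n G v : G `<=` Rn R n ->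
  Gamma_orbit (Symn n.+1) G v -> v n = 0 -> Gamma_orbit (Symn n) G v.
Proof.
move=> Gn [t tn [g Gg ->]] gz; set z := t^-1%FUN n in gz *.
exists (t \o swap z n).
  move=> i; rewrite leq_eqVlt => /predU1P[<-|ni] /=.
    by rewrite swapR permKV.
  rewrite swapD ?tn//; [move=> iz|lia].
  by have := tn i ni; rewrite iz permKV => nz; move: ni; rewrite iz -nz ltnn.
exists g => //; rewrite act_compE act_swap_id//.
by rewrite [RHS](Gn g Gg n).
Qed.

(* Two elements of the orbit of [G], having at most [p] nonzero entries each,
   share a zero coordinate [b < n]; swapping [b] and [n] fixes any
   combination of them that vanishes at [n]. *)
Lemma cone_orbit_shrink p n G u : G `<=` Rn R p -> (p + p < n)%N ->
  cone (Gamma_orbit (Symn n.+1) G) u -> u n = 0 ->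
  cone (Gamma_orbit (Symn n) G) u.
Proof.
move=> Gp pn; have Gn : G `<=` Rn R n by move=> g /Gp; apply: Rn_mono; lia.
have [_ KD KZ] := cone_convex (Gamma_orbit (Symn n) G).
apply: cone_elim; first exact: cone_convex.
  by move=> a Ga an; apply: sub_cone; exact: orbit_shrink.
move=> a b Ga Gb an bn.
have [z zn [az bz]] : exists2 z, (z < n)%N & a z = 0 /\ b z = 0.
  have [s sn [g Gg ea]] := Ga; have [t tn [h Gh eb]] := Gb.
  (* The list covers both supports and has length [p + p < n]. *)
  have [|z zn] := @exists_fresh n (map s (iota 0 p) ++ map t (iota 0 p)).
    by rewrite size_cat !size_map size_iota.
  rewrite mem_cat negb_or => /andP[zs zt]; exists z => //.
  split; rewrite ?ea ?eb actE (Gp _ _)//.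
    rewrite leqNgt; apply: contra zs => zp; apply/mapP.
    by exists (s^-1%FUN z); rewrite ?mem_iota// permKV.
  rewrite leqNgt; apply: contra zt => zp; apply/mapP.
  by exists (t^-1%FUN z); rewrite ?mem_iota// permKV.
have shift v : Gamma_orbit (Symn n.+1) G v -> v z = 0 ->
    cone (Gamma_orbit (Symn n) G) (act (swap z n) v).
  move=> Gv vz; apply/sub_cone/orbit_shrink => //; last by rewrite act_swap swapR.
  by apply: orbit_act => //; apply: Symn_swap; lia.
have -> : (- b n) *: a + a n *: b = act (swap z n) ((- b n) *: a + a n *: b).
  rewrite act_swap_id// !rseqDE !rseqZE az bz !mulr0 addr0 mulNr mulrC.
  by rewrite addNr.
rewrite actD !actZ; apply: KD; apply: KZ; rewrite ?ltW ?oppr_gt0//; exact: shift.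
Qed.

(** Removes the coordinates from [m - 1] down to [n] one by one; [p + p] stays below every dimension
    reached. *)
Lemma cone_orbit_Rn p m n G u : G `<=` Rn R p -> (p + p < n)%N -> (n <= m)%N ->
  cone (Gamma_orbit (Symn m) G) u -> Rn R n u ->
  cone (Gamma_orbit (Symn n) G) u.
Proof.
move=> Gp pn /subnK <-; elim: (m - n)%N => [//|k IH] Gu un.
by apply: IH => //; apply: (@cone_orbit_shrink p (k + n)) Gp _ Gu (un _ _); lia.
Qed.

(** A finite combination uses finitely many permutations, which all lie in one [Symn n]. *)
Lemma cone_orbit_Sym A u : cone (Gamma_orbit Sym A) u ->
  exists n, cone (Gamma_orbit (Symn n) A) u.
Proof.
pose K := [set v | exists n, cone (Gamma_orbit (Symn n) A) v].
suff Kc : convex_cone K.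
  apply: (cone_sub Kc) => _ [s /Sym_Symn[n sn] [a Aa ->]].
  by exists n; apply: sub_cone; exists s => //; exists a.
split=> [|v w [n nv] [m mw]|c v c0 [n nv]].
- by exists 0%N; have [] := cone_convex (Gamma_orbit (Symn 0) A).
- exists (maxn n m); have [_ KD _] := cone_convex (Gamma_orbit (Symn (maxn n m)) A).
  apply: KD; [move: nv|move: mw]; apply: cone_mono; apply: orbit_mono; lia.
- by exists n; have [_ _ KZ] := cone_convex (Gamma_orbit (Symn n) A); exact: KZ.
Qed.

End Permutations.

(** * Caratheodory's theorem for cones *)

Section Caratheodory.
Variable R : realType.
Implicit Types (A : set (rseq R)) (u : rseq R).

Lemma Rn_dependence N k (a : 'I_k.+1 -> rseq R) : (N <= k)%N ->
  (forall i, Rn R N (a i)) ->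
  exists2 l : 'I_k.+1 -> R, (exists i, 0 < l i) & \sum_i l i *: a i = 0.
Proof.
move=> Nk aN; pose M := \matrix_(i < k.+1, j < N) a i j.
have : kermx M != 0.
  by rewrite kermx_eq0 -row_leq_rank -ltnNge ltnS (leq_trans (rank_leq_col M)).
case/rowV0Pn => v /sub_kermxP vM vn0.
have vsum : \sum_i v 0 i *: a i = 0.
  apply/funext => j; rewrite fct_sumE; have [jN|Nj] := ltnP j N.
    have /matrixP/(_ 0 (Ordinal jN)) := vM; rewrite !mxE => e.
    by rewrite -[RHS]e; apply: eq_bigr => i _; rewrite !mxE.
  by apply: big1 => i _; rewrite rseqZE aN// mulr0.
have /rV0Pn[i vi] := vn0.
(* If the nonzero entry is negative, changing the sign of the whole relation makes it positive. *)
have [vi0|vi0] := ltP 0 (v 0 i); first by exists (v 0); [exists i|].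
exists (fun i => - v 0 i).
  by exists i; rewrite oppr_gt0 lt_neqAle vi.
by under eq_bigr do rewrite scaleNr; rewrite sumrN vsum oppr0.
Qed.

(** From a combination of more than [N] generators, the largest multiple of a linear relation that
    keeps all coefficients nonnegative is subtracted; one coefficient becomes zero and its term is
    dropped. *)
Lemma caratheodory N A u : A `<=` Rn R N -> cone A u ->
  exists (k : nat) (c : 'I_k -> R) (a : 'I_k -> rseq R),
    [/\ (k <= N)%N, forall i, 0 <= c i, forall i, A (a i)
      & u = \sum_i c i *: a i].
Proof.
move=> AN [k]; elim: k => [|k IH] [c [a [c0 Aa eu]]]; first by exists 0%N, c, a.
have [kN|Nk] := ltnP k N; first by exists k.+1, c, a.
have [l [j lj] l0] := Rn_dependence Nk (fun i => AN _ (Aa i)).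
pose m := [arg min_(i < j | 0 < l i) (c i / l i)]%O.
have [lm mmin] : 0 < l m /\ forall i, 0 < l i -> c m / l m <= c i / l i.
  by rewrite /m; case: arg_minP.
pose t := c m / l m; pose d i := c i - t * l i.
have d0 i : 0 <= d i.
  rewrite subr_ge0; have [li|li] := ltP 0 (l i).
    by rewrite -ler_pdivlMr// mmin.
  by rewrite (le_trans _ (c0 i))// mulr_ge0_le0// divr_ge0// ltW.
apply: IH; exists (d \o lift m), (a \o lift m); split=> [i|i|]; [exact: d0|exact: Aa|].
rewrite eu; have -> : \sum_i c i *: a i = \sum_i d i *: a i.
  under [RHS]eq_bigr do rewrite scalerBl -scalerA.
  by rewrite sumrB -scaler_sumr l0 scaler0 subr0.
by rewrite (bigD1_ord m)//= {1}/d /t divfK ?gt_eqF// subrr scale0r add0r.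
Qed.

End Caratheodory.

(** Double counting of ordered pairs in [X]: the diagonal accounts for [#|X|] of them and each [S i]
    covers at most [p ^ 2], too few for all. *)
Lemma exists_uncovered_pair (T : finType) (k p : nat) (X : pred T)
    (S : 'I_k -> pred T) :
  (forall i, #|S i| <= p)%N -> (#|X| + k * p ^ 2 < #|X| ^ 2)%N ->
  exists a b, [/\ X a, X b, a != b & forall i, ~~ (S i a && S i b)].
Proof.
move=> Sp; apply: contraPP => /forallNP H; apply/negP; rewrite -leqNgt.
have card_sum (P : pred T) : #|P| = (\sum_(a | P a) 1)%N by rewrite -sum1_card.
have -> : (#|X| ^ 2 = \sum_(a | X a) \sum_(b | X b) 1)%N.
  by rewrite -card_sum sum_nat_const mulnn.
(* Under the contrary assumption each pair is diagonal or covered, so its summand is at least 1. *)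
apply: (@leq_trans (\sum_(a | X a) \sum_(b | X b)
    ((a == b) + \sum_(i < k) S i a * S i b))%N).
  apply: leq_sum => a Xa; apply: leq_sum => b Xb.
  have [//|ab] := eqVneq a b; rewrite add0n lt0n sum_nat_eq0.
  apply/negP => /forallP /= nS; apply: (H a); exists b; split=> // i.
  by have := nS i; case: (S i a); case: (S i b).
under eq_bigr do rewrite big_split /=; rewrite big_split /=; apply: leq_add.
  rewrite card_sum; apply: leq_sum => a Xa.
  by rewrite (bigD1 a)//= eqxx big1 ?addn0// => b /andP[_ /negPf]; rewrite eq_sym => ->.
under eq_bigr do rewrite exchange_big /=; rewrite exchange_big /=.
have -> : (k * p ^ 2 = \sum_(i < k) p ^ 2)%N by rewrite sum_nat_const card_ord.
apply: leq_sum => i _.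
under eq_bigr do rewrite -big_distrr /=.
rewrite -big_distrl /= mulnn leq_sqr; apply: leq_trans (Sp i).
rewrite card_sum big_mkcond [leqRHS]big_mkcond; apply: leq_sum => a _.
by case: (X a); case: (S i a).
Qed.

(** * Merging the last two entries *)

Section Merging.
Variable R : realType.
Implicit Types (G K : set (rseq R)) (u v w : rseq R) (s t : nat_perm).

Lemma merge_lastD n u v :
  merge_last n (u + v) = merge_last n u + merge_last n v.
Proof.
apply/funext => i; rewrite rseqDE /merge_last.
by case: ifP => // _; case: ifP => _; rewrite ?addr0// !rseqDE addrACA.
Qed.

Lemma merge_lastZ n (c : R) u : merge_last n (c *: u) = c *: merge_last n u.
Proof.
apply/funext => i; rewrite rseqZE /merge_last.
by case: ifP => // _; case: ifP => _; rewrite ?mulr0// !rseqZE mulrDr.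
Qed.

Lemma merge_last_id n w : Rn R n.+2 w -> w n.+1 = 0 -> merge_last n.+1 w = w.
Proof.
move=> wn w0; apply/funext => i; rewrite /merge_last /=; case: ltngtP => // [ni|->].
  have [->|i1] := eqVneq i n.+1; first by rewrite w0.
  by rewrite wn//; lia.
by rewrite w0 addr0.
Qed.

(** When one of the merged entries is zero, merging only drops that zero, so the result is still a
    permuted generator. *)
Lemma merge_last_orbit n G w : G `<=` Rn R n.+1 ->
  Gamma_orbit (Symn n.+2) G w -> w n * w n.+1 = 0 ->
  Gamma_orbit (Symn n.+1) G (merge_last n.+1 w).
Proof.
move=> Gn Gw /eqP; rewrite mulf_eq0 => w0.
have wn : Rn R n.+2 w := orbit_Rn Gn (leqnSn _) Gw.
have [z|z] := eqVneq (w n.+1) 0.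
  by rewrite merge_last_id//; exact: orbit_shrink.
move: w0; rewrite (negPf z) orbF => /eqP w0.
have sn : Symn n.+2 (swap n n.+1) by apply: Symn_swap; lia.
(* Merging is symmetric in the two entries, so the zero may be put last. *)
have -> : merge_last n.+1 w = merge_last n.+1 (act (swap n n.+1) w).
  apply/funext => i; rewrite /merge_last /= !act_swap swapL swapR [in RHS]addrC.
  by case: ltnP => // ni; rewrite swapD//; lia.
rewrite merge_last_id ?act_swap ?swapR//; last exact: Rn_act.
by apply: orbit_shrink => //; [exact: orbit_act|rewrite act_swap swapR].
Qed.

(** [c] is the index that the transposition placing [b] carries to [a]; as [a != b] it is not
    [n.+1], so the inner transposition leaves [n.+1] in place. *)
Lemma exists_perm_last n a b : (a < n.+2)%N -> (b < n.+2)%N -> a != b ->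
  exists s, [/\ Symn n.+2 s, s n = a & s n.+1 = b].
Proof.
move=> an bn ab; pose c := swap b n.+1 a.
have cn : (c < n.+2)%N by rewrite /c (Symn_lt _ (Symn_swap bn (ltnSn _))).
have cn1 : n.+1 <> c.
  by move=> e; move/eqP: ab; apply; rewrite -[a](swapK b n.+1) -/c -e swapR.
exists (swap b n.+1 \o swap n c); split => /=.
- by apply: SymnM; apply: Symn_swap => //; lia.
- by rewrite swapL /c swapK.
- by rewrite (@swapD n c) ?swapR//; lia.
Qed.

(* By Caratheodory [u] is a combination of at most [N = n + 2] elements of the
   orbit, whose supports together cover at most [N p ^ 2] of the pairs of
   indices; on the other hand at least [N / 2] entries of [u] have the same
   sign.  A pair of such indices that no support covers can be merged. *)
Lemma cone_orbit_merge p n G u : G `<=` Rn R p -> (4 * p ^ 2 + 4 <= n.+1)%N ->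
  cone (Gamma_orbit (Symn n.+2) G) u ->
  exists s, [/\ Symn n.+2 s, 0 <= u (s n) * u (s n.+1) &
    cone (Gamma_orbit (Symn n.+1) G) (merge_last n.+1 (u \o s))].
Proof.
move=> Gp pn Gu.
have p_le : (p <= n.+1)%N by nia.
have Gn : G `<=` Rn R n.+1 by move=> g /Gp; exact: Rn_mono.
have [k [c [a [kn c0 Ga eu]]]] := caratheodory (orbit_Rn Gp (leqW p_le)) Gu.
pose S i := [pred j : 'I_n.+2 | a i j != 0].
have Sp i : (#|S i| <= p)%N.
  have [s sn [g /Gp gp ea]] := Ga i; rewrite cardE -(size_map (@nat_of_ord n.+2)).
  rewrite -[leqRHS](size_iota 0) -[leqRHS](size_map s); apply: uniq_leq_size.
    by rewrite map_inj_uniq ?enum_uniq//; exact: ord_inj.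
  move=> _ /mapP[j + ->]; rewrite mem_enum inE /= ea actE => gj.
  apply/mapP; exists (s^-1%FUN j); last by rewrite permKV.
  by rewrite mem_iota leq0n add0n ltnNge; apply: contra gj => /gp ->.
(* [X] collects the nonnegative entries or the negative ones, whichever make up at least half of
   all. *)
have [X Xn Xu] : exists2 X : pred 'I_n.+2, (n.+2 <= #|X| + #|X|)%N &
    forall i j, X i -> X j -> 0 <= u i * u j.
  pose X := [pred i : 'I_n.+2 | 0 <= u i].
  have XC := cardC X; rewrite card_ord in XC.
  have [le|lt] := leqP n.+2 (#|X| + #|X|).
    by exists X => // i j /= ui uj; exact: mulr_ge0.
  exists [predC X]; first by rewrite -{1}XC leq_add2r ltnW// -(ltn_add2l #|X|) XC.
  by move=> i j /=; rewrite -!ltNge => ui uj; rewrite mulr_le0// ltW.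
have [|i [j [Xi Xj ij Sij]]] := @exists_uncovered_pair _ k p X S Sp.
  (* The constant [4 * p ^ 2 + 4] enters here: with [x = #|X|] and [P = p ^ 2],
     [2 * x >= n.+2 >= 4 * P + 5] gives [x ^ 2 > x + 2 * x * P], while [k * P <= 2 * x * P]. *)
  have : (k * p ^ 2 <= n.+2 * p ^ 2)%N by rewrite leq_mul2r kn orbT.
  move: Xn pn; rewrite -(mulnn #|X|); move: #|X| (p ^ 2)%N (k * p ^ 2)%N => x P y.
  move=> Nx PN yN.
  have : (n.+2 * P <= (x + x) * P)%N by rewrite leq_mul2r Nx orbT.
  have : (x * (4 * P + 5) <= x * (x + x))%N by rewrite leq_mul2l; lia.
  by lia.
have [s [sn si sj]] := exists_perm_last (ltn_ord i) (ltn_ord j) ij.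
exists s; split=> //; first by rewrite si sj Xu.
(* [f] is linear, so each term can be treated alone; there the uncovered pair puts a zero among the
   two merged entries. *)
pose f v := merge_last n.+1 (act s^-1%FUN v).
rewrite -act_inv -/(f u).
suff : (f @^-1` cone (Gamma_orbit (Symn n.+1) G)) (\sum_i c i *: a i).
  by rewrite /= -eu.
have Kc : convex_cone (f @^-1` cone (Gamma_orbit (Symn n.+1) G)).
  apply: convex_cone_preimage (cone_convex _) => [v w|d v].
    by rewrite /f actD merge_lastD.
  by rewrite /f actZ merge_lastZ.
apply: convex_cone_sum => // l; case: (Kc) => _ _; apply=> //=.
apply/sub_cone/merge_last_orbit => //; first exact/orbit_act/Ga/SymnV.
have := Sij l; rewrite act_inv /= si sj negb_and !negbK => /orP[]/eqP ->.
  by rewrite mul0r.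
by rewrite mulr0.
Qed.

(* [l] is the proportion in which [u] splits the merged entry. *)
Lemma merge_split n u : Rn R n.+2 u -> 0 <= u n * u n.+1 ->
  exists2 l : R, 0 <= l <= 1 &
    u = l *: merge_last n.+1 u + (1 - l) *: act (swap n n.+1) (merge_last n.+1 u).
Proof.
move=> un uu; set x := u n in uu *; set y := u n.+1 in uu *.
have [l l01 [xl yl]] : exists2 l : R, 0 <= l <= 1 &
    x = l * (x + y) /\ y = (1 - l) * (x + y).
  (* As the product is nonnegative, a zero sum forces [x = y = 0], and any [l] works. *)
  have [xy0|xy0] := eqVneq (x + y) 0.
    have xy : x = - y by apply/eqP; rewrite -addr_eq0 xy0.
    have y0 : y = 0.
      apply/eqP; rewrite -sqrf_eq0 eq_le sqr_ge0 andbT expr2.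
      by move: uu; rewrite xy mulNr oppr_ge0.
    have x0 : x = 0 by rewrite xy y0 oppr0.
    by exists 0; rewrite ?lexx ?ler01// x0 y0 addr0 !mulr0.
  exists (x / (x + y)); last first.
    by split; [rewrite divfK|rewrite mulrBl mul1r divfK// addrAC subrr add0r].
  have s0 : 0 < (x + y) ^+ 2 by rewrite lt_neqAle sqr_ge0 eq_sym sqrf_eq0 xy0.
  (* Over the squared denominator both bounds follow from [0 <= x * y] without a case distinction on
     signs. *)
  have -> : x / (x + y) = (x * x + x * y) / (x + y) ^+ 2.
    by rewrite -mulrDr expr2 invfM mulrACA divff// mulr1.
  apply/andP; split.
    by rewrite divr_ge0 ?(ltW s0)// addr_ge0// -expr2 sqr_ge0.
  rewrite ler_pdivrMr// mul1r -subr_ge0.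
  rewrite (_ : _ - _ = x * y + y * y); last by ring.
  by rewrite addr_ge0// -expr2 sqr_ge0.
exists l => //; apply/funext => i; rewrite rseqDE !rseqZE act_swap /merge_last /swap /=.
rewrite -/x -/y.
case: (ltngtP i n) => [ni|ni|->].
- rewrite (_ : (i == n.+1) = false); last lia.
  by rewrite ni -mulrDl addrC subrK mul1r.
- have [->|ni'] := eqVneq i n.+1; first by rewrite ltnn eqxx mulr0 add0r.
  rewrite (_ : (i < n)%N = false); last lia.
  rewrite (_ : (i == n) = false); last lia.
  by rewrite !mulr0 addr0 un//; lia.
- rewrite (_ : (n.+1 < n)%N = false); last lia.
  by rewrite (_ : (n.+1 == n) = false) ?mulr0 ?addr0//; lia.
Qed.

End Merging.

(** * Invariant chains and the cycle of implications *)

Section Chains.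
Variables (R : realType) (C : nat -> set (rseq R)).
Hypothesis hC : Sym_invariant_chain C.

Implicit Types (m n : nat) (u : rseq R) (s : nat_perm).

Lemma chain_Rn n : (0 < n)%N -> C n `<=` Rn R n.
Proof. by move=> /hC[]. Qed.

Lemma chain_convex n : (0 < n)%N -> convex_cone (C n).
Proof. by move=> /hC[]. Qed.

Lemma chain_act n s u : (0 < n)%N -> Symn n s -> C n u -> C n (act s u).
Proof. by move=> /hC[_ _ + _]; apply. Qed.

Lemma chain_mono m n : (0 < m)%N -> (m <= n)%N -> C m `<=` C n.
Proof.
move=> m0 /subnK <-; elim: (n - m)%N => [|k IH] //=.
have [|_ _ _ +] := @hC (k + m) _; first lia.
exact: subset_trans.
Qed.

Lemma chain_cone_orbit n (A : set (rseq R)) : (0 < n)%N -> A `<=` C n ->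
  cone (Gamma_orbit (Symn n) A) `<=` C n.
Proof.
move=> n0 An; apply: cone_sub (chain_convex n0) _ => _ [s sn [a Aa ->]].
by apply: chain_act => //; exact: An.
Qed.

Lemma chain_limit_max n u : (0 < n)%N -> chain_limit C u ->
  exists2 m, (n <= m)%N & C m u.
Proof.
move=> n0 [m /= m0 Cu]; exists (maxn m n); first lia.
by apply: chain_mono Cu => //; lia.
Qed.

Lemma stabilizes_generated : stabilizes C ->
  exists2 p, (0 < p)%N & exists2 G : set (rseq R), G `<=` Rn R p &
    forall n, (p <= n)%N -> C n = cone (Gamma_orbit (Symn n) G).
Proof.
move=> [r r0 Cr]; exists r => //; exists (C r); first exact: chain_Rn.
by move=> n rn; exact: Cr.
Qed.

Lemma chain_limit_Rn q n : (0 < q)%N -> (q <= n)%N ->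
  (forall m u, (n <= m)%N -> C m u -> Rn R n u -> C n u) ->
  chain_limit C `&` Rn R n = C n.
Proof.
move=> q0 qn Cmn; have n0 : (0 < n)%N by lia.
apply/seteqP; split=> [u [/(chain_limit_max n0)[m nm Cu]]|u Cu]; first exact: Cmn Cu.
by split; [exists n|exact: chain_Rn Cu].
Qed.

Lemma generated_merge :
  (exists2 p, (0 < p)%N & exists2 G : set (rseq R), G `<=` Rn R p &
    forall n, (p <= n)%N -> C n = cone (Gamma_orbit (Symn n) G)) ->
  exists2 q, (0 < q)%N & forall n, (q <= n)%N ->
    chain_limit C `&` Rn R n = C n /\
    forall u, C n.+1 u -> exists s : nat_perm,
      [/\ Symn n.+1 s, 0 <= u (s n.-1) * u (s n)
        & C n (merge_last n (u \o s))].
Proof.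
(* The bound under which merging is possible; it also exceeds [p + p], as elimination requires. *)
move=> [p p0 [G Gp CG]]; exists (4 * p ^ 2 + 4)%N => [|n qn]; first lia.
have pn : (p <= n)%N by nia.
have ppn : (p + p < n)%N by nia.
split.
  apply: (chain_limit_Rn p0 pn) => m u nm; rewrite !CG//; last exact: leq_trans nm.
  exact: cone_orbit_Rn Gp ppn nm.
case: n qn pn {ppn} => [|n] qn pn u; first lia.
by rewrite (CG n.+1 pn) (CG n.+2 (leqW pn)) => Gu; exact: cone_orbit_merge Gp qn Gu.
Qed.

Lemma merge_bounded_support :
  (exists2 q, (0 < q)%N & forall n, (q <= n)%N ->
    chain_limit C `&` Rn R n = C n /\
    forall u, C n.+1 u -> exists s : nat_perm,
      [/\ Symn n.+1 s, 0 <= u (s n.-1) * u (s n)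
        & C n (merge_last n (u \o s))]) ->
  exists2 q, (0 < q)%N & forall n, (q <= n)%N ->
    chain_limit C `&` Rn R n = C n /\
    exists2 S : set (rseq R),
      S `<=` C n `&` [set u | (support_size u <= q)%N] & C n = cone S.
Proof.
move=> [q q0 Cq]; exists q => // n qn; split; first by have [] := Cq n qn.
pose S n := C n `&` [set u | (support_size u <= q)%N].
exists (S n) => //; apply/seteqP; split; last first.
  by apply: cone_sub; [apply: chain_convex; lia|move=> u []].
have Sact m s u : (0 < m)%N -> Symn m s -> cone (S m) u -> cone (S m) (act s u).
  move=> m0 sm Su; suff : (act s @^-1` cone (S m)) u by [].
  apply: (cone_sub (act_convex _ (cone_convex _)) _ Su) => a [Ca aq].
  apply: sub_cone; split; first exact: chain_act.
  by rewrite /= (support_size_act _ (chain_Rn m0 Ca)).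
(* Induction on the dimension from [q], where all vectors have small support; the step rebuilds [u]
   from its merged vector, which lies one dimension lower. *)
move: qn => /subnK <-; elim: (n - q)%N => [|k IH] u /=.
  move=> Cu; apply: sub_cone; split=> //; apply: support_size_Rn.
  by apply: chain_Rn Cu.
have [m em] : exists m, (k + q = m.+1)%N by exists (k + q).-1; lia.
rewrite addSn em; rewrite em in IH; move=> Cu.
have [|_ /(_ u Cu)[s [sn us Cw]]] := Cq m.+1; first lia.
set w := merge_last _ _ in Cw.
have un : Rn R m.+2 (u \o s).
  by rewrite -act_inv; apply/Rn_act/chain_Rn => //; exact: SymnV.
have [l /andP[l0 l1] e] := merge_split un us.
have Sw : cone (S m.+2) w.
  apply: cone_mono (IH _ Cw) => v [Cv vq]; split=> //.
  by apply: chain_mono Cv.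
have -> : u = act s (u \o s) by rewrite -act_inv actKV.
apply: (Sact) => //; rewrite e; have [_ KD KZ] := cone_convex (S m.+2).
apply: KD; apply: KZ => //; first by rewrite subr_ge0.
by apply: Sact => //; apply: Symn_swap; lia.
Qed.

Lemma bounded_support_limit :
  (exists2 q, (0 < q)%N & forall n, (q <= n)%N ->
    chain_limit C `&` Rn R n = C n /\
    exists2 S : set (rseq R),
      S `<=` C n `&` [set u | (support_size u <= q)%N] & C n = cone S) ->
  exists2 r, (0 < r)%N & exists2 A : set (rseq R), A `<=` C r &
    chain_limit C = cone (Gamma_orbit Sym A).
Proof.
move=> [q q0 Cq]; exists q => //; exists (C q) => //.
apply/seteqP; split=> u.
  move=> /(chain_limit_max q0)[n qn]; have n0 : (0 < n)%N by lia.
  have [_ [S SC ->]] := Cq n qn.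
  apply: cone_mono => a /SC[Ca aq].
  have [s sn sa] := Rn_compress qn (chain_Rn n0 Ca) aq.
  exists (s^-1%FUN : nat_perm); first exact/Symn_Sym/SymnV/sn.
  exists (act s a); last by rewrite actK.
  (* Condition (a) at [q] puts the compressed generator, an element of the limit lying in [Rn R q],
     into [C q]. *)
  have [<- _] := Cq q (leqnn q); split=> //.
  by exists n => //; exact: chain_act.
move=> /cone_orbit_Sym[n Cu]; exists (maxn n q); first by rewrite /=; lia.
have n0 : (0 < maxn n q)%N by lia.
apply: (chain_cone_orbit n0 (chain_mono q0 (leq_maxr n q))).
by apply: cone_mono Cu; apply: orbit_mono; exact: leq_maxl.
Qed.

Lemma limit_stabilizes :
  (exists2 r, (0 < r)%N & exists2 A : set (rseq R), A `<=` C r &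
    chain_limit C = cone (Gamma_orbit Sym A)) ->
  stabilizes C.
Proof.
(* Elimination for generators in [Rn R r] works in dimensions above [r + r]. *)
move=> [r r0 [A Ar CA]]; exists (r + r).+1 => // m n rm mn.
have m0 : (0 < m)%N by lia.
have n0 : (0 < n)%N by lia.
apply/seteqP; split; last by apply: chain_cone_orbit => //; exact: chain_mono.
move=> u Cu; have : chain_limit C u by exists n.
rewrite CA => /cone_orbit_Sym[k Au].
have {}Au : cone (Gamma_orbit (Symn (maxn k n)) A) u.
  by apply: cone_mono Au; apply: orbit_mono; exact: leq_maxl.
(* The permutations used so far may move indices beyond [n]; since [u] lies in [Rn R n], elimination
   brings them back to [Symn n]. *)
have {}Au : cone (Gamma_orbit (Symn n) A) u.
  apply: (cone_orbit_Rn (p := r)) Au (chain_Rn n0 Cu); [|lia|exact: leq_maxr].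
  exact: subset_trans Ar (chain_Rn r0).
apply: cone_mono Au => _ [s sn [a Aa ->]]; exists s => //; exists a => //.
by apply: chain_mono (Ar _ Aa) => //; lia.
Qed.

End Chains.

Theorem theorem4p3 (R : realType) (C : nat -> set (rseq R))
    (hC : Sym_invariant_chain C) :
  [<-> stabilizes C;
       exists2 p, (0 < p)%N & exists2 G : set (rseq R), G `<=` Rn R p &
         forall n, (p <= n)%N -> C n = cone (Gamma_orbit (Symn n) G);
       exists2 q, (0 < q)%N & forall n, (q <= n)%N ->
         chain_limit C `&` Rn R n = C n /\
         forall u, C n.+1 u -> exists s : nat_perm,
           [/\ Symn n.+1 s, 0 <= u (s n.-1) * u (s n)
             & C n (merge_last n (u \o s))];
       exists2 q, (0 < q)%N & forall n, (q <= n)%N ->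
         chain_limit C `&` Rn R n = C n /\
         exists2 S : set (rseq R),
           S `<=` C n `&` [set u | (support_size u <= q)%N] & C n = cone S;
       exists2 r, (0 < r)%N & exists2 A : set (rseq R), A `<=` C r &
         chain_limit C = cone (Gamma_orbit Sym A)].
Proof.
tfae.
- exact: stabilizes_generated.
- exact: generated_merge.
- exact: merge_bounded_support.
- exact: bounded_support_limit.
- exact: limit_stabilizes.
Qed.
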